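(* Consider the one-dimensional PCP finite volume HWENO scheme for the special relativistic hydrodynamics equations with the Lax--Friedrichs flux, whose spatial operator for the cell averages is $$\mathcal L_U(\mathbf U_h,i)=-\frac{\hat{\mathbf F}_{i+1/2}-\hat{\mathbf F}_{i-1/2}}{\Delta x},$$ $$\hat{\mathbf F}_{i+1/2}=\tfrac12\Big(\mathbf F(\mathbf U_{i\oplus\frac12})+\mathbf F(\mathbf U_{(i+1)\oplus(-\frac12)})-\alpha\big(\mathbf U_{(i+1)\oplus(-\frac12)}-\mathbf U_{i\oplus\frac12}\big)\Big),$$ where $\mathbf U_{i\oplus a}$ are the PCP-limited HWENO point values described in the context and $\alpha=\max_i\max\{\varrho_1(\mathbf U_{i\oplus\frac12}),\varrho_1(\mathbf U_{(i+1)\oplus(-\frac12)})\}$. If $\overline{\mathbf U}_i\in\mathcal G$ for all $i$, then $$\overline{\mathbf U}_i+\Delta t\,\mathcal L_U(\mathbf U_h,i)\in\mathcal G\qquad\text{for all } i$$ under the CFL condition $$\Delta t\le\frac{\hat\omega_1\Delta x}{\alpha}.$$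
   Context: **Equations.** $\gamma\in(1,2]$. $\mathbf U=(D,m_1,E)^\top$, $\mathbf F(\mathbf U)=(Dv_1,\,m_1v_1+p,\,m_1)^\top$ (also written $\mathbf F_1$). $\mathcal G=\{(D,m_1,E)^\top\in\mathbb R^3: D>0,\ g(\mathbf U):=E-\sqrt{D^2+m_1^2}>0\}$. For $\mathbf U\in\mathcal G$, $(\rho,v_1,p)$ is the unique triple with $\rho>0$, $p>0$, $|v_1|<1$ and $D=\rho W$, $m_1=DhWv_1$, $E=DhW-p$, where $W=1/\sqrt{1-v_1^2}$, $h=1+e+p/\rho$, $e=\frac p{(\gamma-1)\rho}$; thus $\mathbf F$ is a function of $\mathbf U\in\mathcal G$. $\varrho_1(\mathbf U)$ is the spectral radius of the Jacobian $\partial\mathbf F/\partial\mathbf U$. Time step $\Delta t>0$. **Mesh and data.** Uniform cells $I_i=[x_{i-1/2},x_{i+1/2}]$ with center $x_i$, size $\Delta x$, finitely many (neighbouring values needed at the boundary come from ghost cells supplied by the boundary conditions, treated like all other cells). $\mathbf U_h$ consists of the zeroth moments (cell averages) $\overline{\mathbf U}_i\approx\frac1{\Delta x}\int_{I_i}\mathbf U\,dx$ and first moments $\overline{\mathbf V}_i\approx\frac1{\Delta x}\int_{I_i}\mathbf U\frac{x-x_i}{\Delta x}dx$. Four-point Gauss--Lobatto weights $\hat\omega_1=\hat\omega_4=\frac1{12}$, $\hat\omega_2=\hat\omega_3=\frac5{12}$ and nodes $\{a_\ell\}_{\ell=1}^4=\{-\frac12,-\frac{\sqrt5}{10},\frac{\sqrt5}{10},\frac12\}$.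 $\mathbf U_{i\oplus a}$ denotes the approximation at $x_i+a\Delta x$ computed within cell $I_i$. **Scalar reconstruction operators.** Given $u_{i-1},u_i,u_{i+1},v_{i-1},v_i,v_{i+1}\in\mathbb R$: $P_0$ is the polynomial of degree $\le5$ with $\frac1{\Delta x}\int_{I_k}P_0=u_k$ and $\frac1{\Delta x}\int_{I_k}P_0\frac{x-x_k}{\Delta x}dx=v_k$, $k=i,i\pm1$. $P_1$ (resp. $P_2$) is the quadratic polynomial with $\frac1{\Delta x}\int_{I_i}P\frac{x-x_i}{\Delta x}dx=v_i$ and $\frac1{\Delta x}\int_{I_k}P=u_k$ for $k=i,i-1$ (resp. $k=i,i+1$). $M_L([u_{i-1},u_i,u_{i+1}],[v_{i-1},v_i,v_{i+1}],\eta)=P_0(x_i+\eta\Delta x)$ and $M_H(\cdot,\cdot,\eta)=P_H(x_i+\eta\Delta x)$, with $P_H=\omega_0\big(\frac1{\gamma_0}P_0-\sum_{n=1}^2\frac{\gamma_n}{\gamma_0}P_n\big)+\sum_{n=1}^2\omega_nP_n$, where $\gamma_0,\gamma_1,\gamma_2>0$ are linear weights with sum $1$, $\omega_n=\bar\omega_n/\sum_k\bar\omega_k$, $\bar\omega_n=\gamma_n\big(1+\frac{\tau^2}{\beta_n^2+\epsilon}\big)$, $\tau=\frac{|\beta_0-\beta_1|+|\beta_0-\beta_2|}2$, $\epsilon>0$ small, $\beta_n=\sum_{s=1}^{r}\int_{I_i}\Delta x^{2s-1}\big(\frac{d^sP_n}{dx^s}\big)^2dx$, $r$ the degree of $P_n$.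 $\mathbf M_L,\mathbf M_H$ apply $M_L,M_H$ componentwise (row by row) to $3\times3$ matrices. **Reconstruction.** Some cells are marked as troubled by a troubled-cell indicator (KXRCF), and the first moments $\overline{\mathbf V}_i$ in those cells are first modified by an HWENO limiter; no property of the indicator or of the modification is needed. With $\mathbf A_i=[\overline{\mathbf U}_{i-1}\ \overline{\mathbf U}_i\ \overline{\mathbf U}_{i+1}]$, $\mathbf B_i=[\overline{\mathbf V}_{i-1}\ \overline{\mathbf V}_i\ \overline{\mathbf V}_{i+1}]$: if $I_i$ is not troubled, $\mathbf U^*_{i\oplus a_\ell}=\mathbf M_L(\mathbf A_i,\mathbf B_i,a_\ell)$, $\ell=1,\dots,4$. If $I_i$ is troubled, $\mathbf U^*_{i\oplus a_\ell}=\mathbf M_H(\mathbf A_i,\mathbf B_i,a_\ell)$ for $\ell=2,3$ and $\mathbf U^*_{i\oplus(\pm\frac12)}=\mathbf R_{i\pm\frac12}\mathbf M_H(\mathbf R^{-1}_{i\pm\frac12}\mathbf A_i,\mathbf R^{-1}_{i\pm\frac12}\mathbf B_i,\pm\frac12)$, where $\mathbf R_{i+\frac12}$ is the invertible matrix of (rescaled) right eigenvectors of a Roe matrix at $x_{i+1/2}$. **PCP limiter.** Write $\mathbf U^*_{i\oplus a_\ell}=(D^*_{i\oplus a_\ell},(m_1)^*_{i\oplus a_\ell},E^*_{i\oplus a_\ell})^\top$ and let $\overline D_i$ be the first component of $\overline{\mathbf U}_i$. Step 1: $\widetilde D_{i\oplus a_\ell}=\theta_D(D^*_{i\oplus a_\ell}-\overline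 D_i)+\overline D_i$, $\theta_D=\min\{|\frac{\overline D_i-\epsilon_D}{\overline D_i-D_{\min}}|,1\}$, $D_{\min}=\min\big\{\min_\ell D^*_{i\oplus a_\ell},\ \frac{\overline D_i-\hat\omega_1D^*_{i\oplus(-\frac12)}-\hat\omega_4D^*_{i\oplus\frac12}}{1-2\hat\omega_1}\big\}$, $\epsilon_D=\min_i\{10^{-13},\overline D_i\}$. Step 2: with $\widetilde{\mathbf U}_{i\oplus a_\ell}=(\widetilde D_{i\oplus a_\ell},(m_1)^*_{i\oplus a_\ell},E^*_{i\oplus a_\ell})^\top$, $\mathbf U_{i\oplus a_\ell}=\theta_g(\widetilde{\mathbf U}_{i\oplus a_\ell}-\overline{\mathbf U}_i)+\overline{\mathbf U}_i$, $\theta_g=\min\{|\frac{g(\overline{\mathbf U}_i)-\epsilon_g}{g(\overline{\mathbf U}_i)-g_{\min}}|,1\}$, $g_{\min}=\min\big\{\min_\ell g(\widetilde{\mathbf U}_{i\oplus a_\ell}),\ g\big(\frac{\overline{\mathbf U}_i-\hat\omega_1\widetilde{\mathbf U}_{i\oplus(-\frac12)}-\hat\omega_4\widetilde{\mathbf U}_{i\oplus\frac12}}{1-2\hat\omega_1}\big)\big\}$, $\epsilon_g=\min_i\{10^{-13},g(\overline{\mathbf U}_i)\}$. ($\theta=1$ when the denominator vanishes.) *)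

(* Defs.v *)
From mathcomp Require Export all_boot all_order all_algebra.
From mathcomp Require Export all_classical all_reals all_analysis.
From mathcomp Require Export complex.

Set Implicit Arguments.
Unset Strict Implicit.
Unset Printing Implicit Defensive.

Export Order.TTheory GRing.Theory Num.Theory.
Export numFieldNormedType.Exports.

Local Open Scope classical_set_scope.
Local Open Scope ring_scope.

Section Equations.
Context {R : realType}.
Implicit Types U : 'cV[R]_3.

Definition mk3 (a b c : R) : 'cV[R]_3 := \col_(k < 3) [:: a; b; c]`_k.

(* U = (D, m_1, E)^T *)
Definition dens U : R := U 0 0.
Definition mom U : R := U 1 0.
Definition ener U : R := U 2 0.

Definition gfun U : R := ener U - Num.sqrt (dens U ^+ 2 + mom U ^+ 2).

Definition admissible : set 'cV[R]_3 := [set U | 0 < dens U /\ 0 < gfun U].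

(* The primitive variables are the triple (rho, v_1, p). *)
Definition is_prim (gamma : R) U (w : R * R * R) : Prop :=
  let: (rho, v, p) := w in
  let W := 1 / Num.sqrt (1 - v ^+ 2) in
  let e := p / ((gamma - 1) * rho) in
  let h := 1 + e + p / rho in
  [/\ 0 < rho, 0 < p, `|v| < 1 &
   [/\ dens U = rho * W, mom U = dens U * h * W * v &
       ener U = dens U * h * W - p]].

(* For gamma in (1, 2] and admissible U there is exactly one such triple; the
   default value is never used on admissible states. *)
Definition prim (gamma : R) U : R * R * R :=
  xget (0, 0, 0) [set w | is_prim gamma U w].

Definition flux (gamma : R) U : 'cV[R]_3 :=
  let: (_, v, p) := prim gamma U in
  mk3 (dens U * v) (mom U * v + p) (mom U).

(* [jacobian] acts on row vectors and has the partial derivative of the j-th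
   component in the i-th direction at position (i, j), hence the transpositions:
   the (i, j) entry below is the partial derivative of F_i in U_j. *)
Definition flux_jac (gamma : R) U : 'M[R]_3 :=
  (jacobian (fun u : 'rV[R]_3 => (flux gamma u^T)^T) U^T)^T.

Definition spectral_radius n (A : 'M[R]_n) : R :=
  sup [set ComplexField.Normc.normc z
      | z in [set z : R[i] | eigenvalue (map_mx (real_complex R) A) z]].

Definition rho1 (gamma : R) U : R := spectral_radius (flux_jac gamma U).

(* Roe's conditions for the pair of states UL, UR; the real diagonalizability
   is expressed by [right_eigenbasis]. *)
Definition roe_matrix (gamma : R) (UL UR : 'cV[R]_3) (A : 'M[R]_3) : Prop :=
  A *m (UR - UL) = flux gamma UR - flux gamma UL /\
  (UL = UR -> A = flux_jac gamma UL).

Definition right_eigenbasis n (A P : 'M[R]_n) : Prop :=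
  P \in unitmx /\
  forall j, exists lambda : R, A *m col j P = lambda *: col j P.

End Equations.

Section Quadrature.
Context {R : realType}.

Definition glw (l : 'I_4) : R := [:: 1 / 12; 5 / 12; 5 / 12; 1 / 12]`_l.

Definition gln (l : 'I_4) : R :=
  [:: - (1 / 2); - (Num.sqrt 5 / 10); Num.sqrt 5 / 10; 1 / 2]`_l.

End Quadrature.

Section ScalarReconstruction.
Context {R : realType}.
(* xc is the center x_i of the cell I_i, and the entries 0, 1, 2 of u and v
   belong to the cells I_{i-1}, I_i, I_{i+1}. *)
Variables (dx xc : R).
Implicit Types (u v : 'rV[R]_3) (P : {poly R}).

Definition cell (c : R) : set R := `[c - dx / 2, c + dx / 2].

Definition center (k : 'I_3) : R := xc + (k%:R - 1) * dx.

Definition poly_avg P (c : R) : R :=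
  dx^-1 * Rintegral lebesgue_measure (cell c) (fun x => P.[x]).

Definition poly_mom P (c : R) : R :=
  dx^-1 * Rintegral lebesgue_measure (cell c)
            (fun x => P.[x] * ((x - c) / dx)).

(* The moment conditions below are unisolvent for dx != 0, so that [xget]
   selects the only polynomial that satisfies them. *)
Definition P0 u v : {poly R} :=
  xget 0 [set P : {poly R} | (size P <= 6)%N /\
    forall k : 'I_3, poly_avg P (center k) = u 0 k /\
                     poly_mom P (center k) = v 0 k].

(* k = 0 gives P_1 and k = 2 gives P_2 *)
Definition Pquad (k : 'I_3) u v : {poly R} :=
  xget 0 [set P : {poly R} | [/\ (size P <= 3)%N,
    poly_mom P (center 1) = v 0 1,
    poly_avg P (center 1) = u 0 1 &
    poly_avg P (center k) = u 0 k]].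

Definition Pn u v (n : 'I_3) : {poly R} :=
  nth 0 [:: P0 u v; Pquad 0 u v; Pquad 2 u v] n.

Definition smoothness P : R :=
  \sum_(1 <= s < size P)
    Rintegral lebesgue_measure (cell xc)
      (fun x => dx ^+ (2 * s - 1) * P^`(s).[x] ^+ 2).

Definition M_L u v (eta : R) : R := (P0 u v).[xc + eta * dx].

Variables (lw : 'I_3 -> R) (eps : R).

Definition P_H u v : {poly R} :=
  let beta n := smoothness (Pn u v n) in
  let tau := (`|beta 0 - beta 1| + `|beta 0 - beta 2|) / 2 in
  let wbar n := lw n * (1 + tau ^+ 2 / (beta n ^+ 2 + eps)) in
  let w n := wbar n / \sum_k wbar k in
  w 0 *: ((1 / lw 0) *: Pn u v 0
          - \sum_(n < 3 | n != 0) (lw n / lw 0) *: Pn u v n)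
  + \sum_(n < 3 | n != 0) w n *: Pn u v n.

Definition M_H u v (eta : R) : R := (P_H u v).[xc + eta * dx].

Definition MM_L (A B : 'M[R]_3) (eta : R) : 'cV[R]_3 :=
  \col_k M_L (row k A) (row k B) eta.

Definition MM_H (A B : 'M[R]_3) (eta : R) : 'cV[R]_3 :=
  \col_k M_H (row k A) (row k B) eta.

End ScalarReconstruction.

(* The cells are indexed by 0, ..., N + 3: the interior cells are 2, ..., N + 1
   and the two cells at each end are ghost cells. The point values are
   reconstructed in the cells 1, ..., N + 2. *)
Section Scheme.
Context {R : realType}.
Variables (gamma : R) (N : nat) (x0 dx : R) (lw : 'I_3 -> R) (eps : R).
(* Vbar holds the original first moments and Vlim those that the HWENO limiter
   puts in their place in the troubled cells; Rm i is R_{i+1/2}. *)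
Variables (troubled : nat -> bool) (Ubar Vbar Vlim : nat -> 'cV[R]_3).
Variable (Rm : nat -> 'M[R]_3).

Definition xcenter (i : nat) : R := x0 + i%:R * dx.

Definition Vmod (i : nat) : 'cV[R]_3 :=
  if troubled i then Vlim i else Vbar i.

(* [X_{i-1} X_i X_{i+1}] *)
Definition stencil (X : nat -> 'cV[R]_3) (i : nat) : 'M[R]_3 :=
  \matrix_(k < 3, c < 3) X (i.-1 + c)%N k 0.

Definition Ustar (i : nat) (l : 'I_4) : 'cV[R]_3 :=
  let A := stencil Ubar i in
  let B := stencil Vmod i in
  let ML := MM_L dx (xcenter i) in
  let MH := MM_H dx (xcenter i) lw eps in
  let charMH P := P *m MH (invmx P *m A) (invmx P *m B) (gln l) in
  if ~~ troubled i then ML A B (gln l)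
  else if l == 0 then charMH (Rm i.-1)
  else if l == ord_max then charMH (Rm i)
  else MH A B (gln l).

Definition eps_D : R := \big[Num.min/10 ^- 13]_(i < N.+4) dens (Ubar i).

Definition eps_g : R := \big[Num.min/10 ^- 13]_(i < N.+4) gfun (Ubar i).

Definition min4 (f : 'I_4 -> R) : R := \big[Num.min/f 0]_(l < 4) f l.

Definition theta (a e b : R) : R :=
  if a - b == 0 then 1 else Num.min `|(a - e) / (a - b)| 1.

Definition D_min (i : nat) : R :=
  let D l := dens (Ustar i l) in
  Num.min (min4 D)
    ((dens (Ubar i) - glw 0 * D 0 - glw ord_max * D ord_max)
       / (1 - 2 * glw 0)).

Definition theta_D (i : nat) : R := theta (dens (Ubar i)) eps_D (D_min i).

Definition Utilde (i : nat) (l : 'I_4) : 'cV[R]_3 :=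
  mk3 (theta_D i * (dens (Ustar i l) - dens (Ubar i)) + dens (Ubar i))
      (mom (Ustar i l)) (ener (Ustar i l)).

Definition g_min (i : nat) : R :=
  Num.min (min4 (fun l => gfun (Utilde i l)))
    (gfun ((1 - 2 * glw 0)^-1 *:
       (Ubar i - glw 0 *: Utilde i 0 - glw ord_max *: Utilde i ord_max))).

Definition theta_g (i : nat) : R := theta (gfun (Ubar i)) eps_g (g_min i).

Definition Upcp (i : nat) (l : 'I_4) : 'cV[R]_3 :=
  theta_g i *: (Utilde i l - Ubar i) + Ubar i.

(* U_{i (+) 1/2} and U_{i (+) (-1/2)} *)
Definition Uright (i : nat) : 'cV[R]_3 := Upcp i ord_max.
Definition Uleft (i : nat) : 'cV[R]_3 := Upcp i 0.

(* The interfaces i + 1/2 between two reconstructed cells are those with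
   1 <= i <= N + 1; spectral radii are nonnegative, hence the neutral 0. *)
Definition alpha : R :=
  \big[Num.max/0]_(1 <= i < N.+2)
    Num.max (rho1 gamma (Uright i)) (rho1 gamma (Uleft i.+1)).

Definition Fhat (i : nat) : 'cV[R]_3 :=
  (1 / 2) *: (flux gamma (Uright i) + flux gamma (Uleft i.+1)
              - alpha *: (Uleft i.+1 - Uright i)).

Definition L_U (i : nat) : 'cV[R]_3 := - (dx^-1 *: (Fhat i - Fhat i.-1)).

End Scheme.

(* Main.v *)
(* The set G is an open convex cone, because g is concave and positively
   homogeneous. The two scalings of the limiter therefore put into G the two end
   values of each cell and the interior remainder
   (average - w (left + right)) / (1 - 2 w), where w = 1/12.

   Under the CFL condition the updated average is a combination with nonnegative
   coefficients of that remainder, of the end values of the cell, and of four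
   states alpha U +- F(U), so it suffices that alpha U +- F(U) lies in G as soon
   as alpha >= rho_1(U). In the rest frame this reduces to
   p^2 q1^2 < ((rho h - p)^2 - rho^2) q0^2 for q0 = alpha +- v, q1 = 1 +- v alpha,
   which holds when alpha >= (|v| + c) / (1 + |v| c), c being the sound speed.

   That this number is at most rho_1(U) requires the derivative of F, hence of the
   implicitly defined pressure. The pressure increment between two states is an
   explicit linear form in the increments of U, with coefficients that are first
   seen to be bounded, then continuous; F is thus differentiable in the sense of
   Caratheodory, with an explicit Jacobian for which (v +- c) / (1 +- v c) is an
   eigenvalue. *)
Require Import Defs.
From mathcomp Require Import ring lra.
Set Implicit Arguments.
Unset Strict Implicit.
Unset Printing Implicit Defensive.
Local Open Scope classical_set_scope.
Local Open Scope ring_scope.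

(** * The open convex cone of admissible states *)

Section ConvexCone.
Context {R : realType}.
Implicit Types U V : 'cV[R]_3.

Lemma sqrt_sqrD_triangle (a b c d : R) :
  Num.sqrt ((a + c) ^+ 2 + (b + d) ^+ 2) <=
  Num.sqrt (a ^+ 2 + b ^+ 2) + Num.sqrt (c ^+ 2 + d ^+ 2).
Proof.
have h1 : 0 <= a ^+ 2 + b ^+ 2 by rewrite addr_ge0 ?sqr_ge0.
have h2 : 0 <= c ^+ 2 + d ^+ 2 by rewrite addr_ge0 ?sqr_ge0.
rewrite -[leRHS]ger0_norm ?addr_ge0 ?sqrtr_ge0// -sqrtr_sqr ler_wsqrtr//.
rewrite [leRHS]sqrrD !sqr_sqrtr// -sqrtrM//.
suff : a * c + b * d <= Num.sqrt ((a ^+ 2 + b ^+ 2) * (c ^+ 2 + d ^+ 2)) by lra.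
apply: (le_trans (ler_norm _)); rewrite -sqrtr_sqr ler_wsqrtr//.
(* By Lagrange's identity the two sides differ by this square. *)
have := sqr_ge0 (a * d - b * c); lra.
Qed.

Lemma gfunD U V : gfun U + gfun V <= gfun (U + V).
Proof.
rewrite /gfun /dens /mom /ener !mxE.
have := sqrt_sqrD_triangle (U 0 0) (U 1 0) (V 0 0) (V 1 0); lra.
Qed.

Lemma gfunZ (a : R) U : 0 <= a -> gfun (a *: U) = a * gfun U.
Proof.
move=> a0; rewrite /gfun /dens /mom /ener !mxE !exprMn -mulrDr.
by rewrite sqrtrM ?sqr_ge0// sqrtr_sqr ger0_norm// mulrBr.
Qed.

Lemma admissibleD U V : admissible U -> admissible V -> admissible (U + V).
Proof.
move=> [U1 U2] [V1 V2]; split; last exact: lt_le_trans (addr_gt0 U2 V2) (gfunD _ _).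
by rewrite /dens mxE addr_gt0.
Qed.

Lemma admissibleZ (a : R) U : 0 < a -> admissible U -> admissible (a *: U).
Proof.
move=> a0 [U1 U2]; split; first by rewrite /dens mxE mulr_gt0.
by rewrite gfunZ ?ltW// mulr_gt0.
Qed.

Lemma admissibleDZ (a : R) U V :
  0 <= a -> admissible U -> admissible V -> admissible (U + a *: V).
Proof.
rewrite le_eqVlt => /predU1P[<-|a0] aU aV; first by rewrite scale0r addr0.
exact/admissibleD/admissibleZ.
Qed.

(** Form without square roots, in which membership is a matter of polynomial inequalities. *)
Lemma admissibleE U : admissible U <->
  [/\ 0 < dens U, 0 < ener U & dens U ^+ 2 + mom U ^+ 2 < ener U ^+ 2].
Proof.
rewrite /admissible /gfun /= subr_gt0; set s := _ + mom U ^+ 2.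
have s0 : 0 <= s by rewrite addr_ge0 ?sqr_ge0.
split=> [[D0 sE]|[D0 E0 sE]].
  have E0 := le_lt_trans (sqrtr_ge0 _) sE.
  by split=> //; rewrite -(sqr_sqrtr s0) ltr_pXn2r ?nnegrE ?sqrtr_ge0 ?ltW.
by split=> //; rewrite -(ger0_norm (ltW E0)) -sqrtr_sqr ltr_sqrt// exprn_gt0.
Qed.

End ConvexCone.

(** * Scalar estimates for the limiter *)

Section Limiter.
Context {R : realType}.

Lemma theta_ge0 (a e b : R) : 0 <= theta a e b.
Proof. by rewrite /theta; case: ifP => // _; rewrite le_min normr_ge0 ler01. Qed.

Lemma theta_le1 (a e b : R) : theta a e b <= 1.
Proof. by rewrite /theta; case: ifP => // _; rewrite ge_min lexx orbT. Qed.

(** The factor satisfies [theta a e b * (a - b) <= a - e]; as [x] is at least [b], the scaled value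
    is at least [e]. If [a = b], the factor is 1 and [x] itself is at least [e]. *)
Lemma theta_scaling_gt0 (a e b x : R) :
  0 < e -> e <= a -> b <= a -> b <= x -> 0 < theta a e b * (x - a) + a.
Proof.
move=> e0 ea ba bx; rewrite /theta; case: ifPn => [/eqP|] ab; first lra.
have ab0 : 0 < a - b by rewrite lt_neqAle eq_sym ab subr_ge0.
rewrite ger0_norm; last by rewrite divr_ge0 ?subr_ge0.
set t := Num.min _ _.
have t0 : 0 <= t by rewrite le_min ler01 andbT divr_ge0 ?subr_ge0.
have tab : t * (a - b) <= a - e by rewrite -ler_pdivlMr// ge_min lexx.
have := ler_wpM2l t0 bx; lra.
Qed.

Lemma min4_le (f : 'I_4 -> R) l : min4 f <= f l.
Proof. by rewrite /min4; apply: bigmin_le_cond. Qed.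

End Limiter.

(** * Admissibility of the limited end values and of the interior remainder *)

Section PCPLimiter.
Context {R : realType}.
Variables (N : nat) (x0 dx : R) (lw : 'I_3 -> R) (eps : R).
Variables (troubled : nat -> bool) (Ubar Vbar Vlim : nat -> 'cV[R]_3).
Variable Rm : nat -> 'M[R]_3.
Hypothesis admUbar : forall i, (i < N.+4)%N -> admissible (Ubar i).

Local Notation Ustar := (Ustar x0 dx lw eps troubled Ubar Vbar Vlim Rm).
Local Notation Utilde := (Utilde N x0 dx lw eps troubled Ubar Vbar Vlim Rm).
Local Notation Upcp := (Upcp N x0 dx lw eps troubled Ubar Vbar Vlim Rm).
Local Notation D_min := (D_min x0 dx lw eps troubled Ubar Vbar Vlim Rm).
Local Notation g_min := (g_min N x0 dx lw eps troubled Ubar Vbar Vlim Rm).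
Local Notation theta_D := (theta_D N x0 dx lw eps troubled Ubar Vbar Vlim Rm).
Local Notation theta_g := (theta_g N x0 dx lw eps troubled Ubar Vbar Vlim Rm).

(* The state that, with the total weight 1 - 2 glw 0 of the two interior
   quadrature nodes, completes the two end values to the cell average. *)
Definition remainder (X : 'I_4 -> 'cV[R]_3) (i : nat) : 'cV[R]_3 :=
  (1 - 2 * glw 0)^-1 *:
    (Ubar i - glw 0 *: X 0 - glw ord_max *: X ord_max).

Lemma remainder_decomposition X i :
  Ubar i = glw 0 *: X 0 + glw ord_max *: X ord_max
           + (1 - 2 * glw 0) *: remainder X i.
Proof.
rewrite /remainder scalerA mulfV ?scale1r; last by rewrite gt_eqF// /glw /=; lra.
by rewrite -[_ - _ - _]addrA -opprD [RHS]addrC subrK.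
Qed.

Lemma eps_D_gt0 : 0 < eps_D N Ubar.
Proof.
apply/lt_bigmin; first by rewrite invr_gt0 exprn_gt0.
by move=> i _; have [] := admUbar (ltn_ord i).
Qed.

Lemma eps_g_gt0 : 0 < eps_g N Ubar.
Proof.
apply/lt_bigmin; first by rewrite invr_gt0 exprn_gt0.
by move=> i _; have [] := admUbar (ltn_ord i).
Qed.

Section Cell.
Variable i : nat.
Hypothesis iN : (i < N.+4)%N.

Lemma eps_D_le : eps_D N Ubar <= dens (Ubar i).
Proof. exact: (@bigmin_le_cond _ _ _ _ (Ordinal iN)). Qed.

Lemma eps_g_le : eps_g N Ubar <= gfun (Ubar i).
Proof. exact: (@bigmin_le_cond _ _ _ _ (Ordinal iN)). Qed.

(** The average is a convex combination of the two end values and of the quotient [q], so the least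
    of these three cannot exceed it. *)
Lemma D_min_le_dens : D_min i <= dens (Ubar i).
Proof.
rewrite /D_min; set q := _ / _.
have : dens (Ubar i) = glw 0 * dens (Ustar i 0)
    + glw ord_max * dens (Ustar i ord_max) + (1 - 2 * glw 0) * q.
  by rewrite /q /glw /=; field.
have := min4_le (fun l => dens (Ustar i l)) 0.
have := min4_le (fun l => dens (Ustar i l)) ord_max.
set m4 := min4 _; rewrite ge_min /glw /=.
by case: (leP q (dens (Ubar i))) => ? *; rewrite ?orbT// orbF; lra.
Qed.

Lemma dens_Utilde_gt0 l : 0 < dens (Utilde i l).
Proof.
rewrite /dens mxE /=; apply: theta_scaling_gt0.
- exact: eps_D_gt0.
- exact: eps_D_le.
- exact: D_min_le_dens.
- by rewrite ge_min (min4_le (fun l => dens (Ustar i l))).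
Qed.

(** Forming the remainder commutes with scaling about the cell average, so the second entry of
    [D_min] acts here as a point value does in [dens_Utilde_gt0]. *)
Lemma dens_remainder_Utilde_gt0 : 0 < dens (remainder (Utilde i) i).
Proof.
set q := (dens (Ubar i) - glw 0 * dens (Ustar i 0)
  - glw ord_max * dens (Ustar i ord_max)) / (1 - 2 * glw 0).
have -> : dens (remainder (Utilde i) i) =
    theta_D i * (q - dens (Ubar i)) + dens (Ubar i).
  by rewrite /remainder /dens !mxE /= -!/(dens _) /q /glw /=; field.
apply: theta_scaling_gt0.
- exact: eps_D_gt0.
- exact: eps_D_le.
- exact: D_min_le_dens.
- by rewrite ge_min /q lexx orbT.
Qed.

(** Jensen's inequality for the concave [gfun], applied to the cell average as a combination of its
    end values and the remainder. *)
Lemma g_min_le_gfun : g_min i <= gfun (Ubar i).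
Proof.
rewrite [X in _ <= gfun X](remainder_decomposition (Utilde i)).
apply: le_trans (gfunD _ _); apply: le_trans (lerD (gfunD _ _) (lexx _)).
rewrite /g_min -/(remainder (Utilde i) i); set r := remainder _ _; clearbody r.
rewrite !gfunZ; [|by rewrite /glw /=; lra..].
have := min4_le (fun l => gfun (Utilde i l)) 0.
have := min4_le (fun l => gfun (Utilde i l)) ord_max.
rewrite /glw /=; set m4 := min4 _; set q := gfun r.
by rewrite ge_min => ? ?; case: (leP q m4) => ?; apply/orP; [right|left]; lra.
Qed.

Lemma admissible_theta_g (U : 'cV[R]_3) : 0 < dens U -> g_min i <= gfun U ->
  admissible (theta_g i *: (U - Ubar i) + Ubar i).
Proof.
move=> D0 gU; have [D1 g1] := admUbar iN.
have t0 : 0 <= theta_g i by exact: theta_ge0.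
have t1 : theta_g i <= 1 by exact: theta_le1.
have -> : theta_g i *: (U - Ubar i) + Ubar i =
    theta_g i *: U + (1 - theta_g i) *: Ubar i.
  by rewrite scalerBr scalerBl scale1r addrAC addrA.
split.
  rewrite /dens !mxE -!/(dens _); move: t0 t1 D0 D1; rewrite !le_eqVlt.
  by move=> /predU1P[<-|t0] => [|/predU1P[->|t1]] D0 D1; nra.
apply: lt_le_trans (gfunD _ _); rewrite !gfunZ ?subr_ge0//.
have := theta_scaling_gt0 eps_g_gt0 eps_g_le g_min_le_gfun gU.
by rewrite -/(theta_g i); lra.
Qed.

Lemma admissible_Upcp l : admissible (Upcp i l).
Proof.
apply: admissible_theta_g; first exact: dens_Utilde_gt0.
by rewrite ge_min (min4_le (fun l => gfun (Utilde i l))).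
Qed.

Lemma admissible_remainder_Upcp : admissible (remainder (Upcp i) i).
Proof.
have -> : remainder (Upcp i) i =
    theta_g i *: (remainder (Utilde i) i - Ubar i) + Ubar i.
  by apply/matrixP => k j; rewrite !mxE /glw /=; field.
apply: admissible_theta_g; first exact: dens_remainder_Utilde_gt0.
by rewrite ge_min lexx orbT.
Qed.

End Cell.
End PCPLimiter.

(** * Existence of the primitive variables *)

Section Primitive.
Context {R : realType}.
Implicit Types (U : 'cV[R]_3) (rho v p gamma : R).

Lemma sqr_lt1 v : `|v| < 1 -> v ^+ 2 < 1.
Proof. by move=> v1; rewrite -real_normK ?num_real// expr_lt1. Qed.

Lemma lorentz_gt0 v : `|v| < 1 -> 0 < Num.sqrt (1 - v ^+ 2).
Proof. by move=> /sqr_lt1; rewrite sqrtr_gt0 subr_gt0. Qed.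

Lemma lorentz_sqr v : `|v| < 1 -> Num.sqrt (1 - v ^+ 2) ^+ 2 = 1 - v ^+ 2.
Proof. by move=> /sqr_lt1 v1; rewrite sqr_sqrtr// subr_ge0 ltW. Qed.

(** Eliminates [W] and [h] through [D h W = E + p]; the last equation expresses the enthalpy density
    [rho h] in two ways. *)
Lemma is_primP gamma U rho v p : 1 < gamma ->
  is_prim gamma U (rho, v, p) <->
  [/\ 0 < rho, 0 < p, `|v| < 1 &
   [/\ rho = dens U * Num.sqrt (1 - v ^+ 2), mom U = (ener U + p) * v &
       (ener U + p) * (1 - v ^+ 2) = rho + gamma / (gamma - 1) * p]].
Proof.
move=> g1; have gN0 : gamma - 1 != 0 by rewrite gt_eqF// subr_gt0.
rewrite /is_prim; set D := dens U; set m := mom U; set E := ener U.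
split=> [] [r0 p0 v1]; have t0 := lorentz_gt0 v1; have := lorentz_sqr v1;
  move: (Num.sqrt _) t0 => t t0 <-; have tN0 := lt0r_neq0 t0;
  have rN0 := lt0r_neq0 r0; move=> [e1 e2 e3]; split=> //.
- split; first by rewrite e1; field.
  + by rewrite e2 e3; field; rewrite ?tN0 ?gN0 ?rN0.
  + by rewrite e3 e1; field; rewrite ?tN0 ?gN0 ?rN0.
- have e4 : D * (1 + p / ((gamma - 1) * rho) + p / rho) * (1 / t) = E + p.
    apply: (mulIf (expf_neq0 2 tN0)); rewrite e3.
    have -> : D = rho / t by rewrite e1; field.
    by field; rewrite tN0 gN0 rN0.
  split; first by rewrite e1; field.
  + by rewrite e4.
  + by rewrite e4; ring.
Qed.

(** With [v = m / (E + p)] the energy relation becomes one scalar equation [f p = 0], solved by the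
    intermediate value theorem. *)
Lemma prim_exists gamma U : 1 < gamma <= 2 -> admissible U ->
  exists w, is_prim gamma U w.
Proof.
move=> /andP[g1 g2] /admissibleE[D0 E0 sE].
pose D := dens U; pose m := mom U; pose E := ener U.
pose f p := p / (gamma - 1) + m ^+ 2 / (E + p)
  + D * Num.sqrt (1 - (m / (E + p)) ^+ 2) - E.
have g10 : 0 < gamma - 1 by rewrite subr_gt0.
have mE p : 0 <= p -> `|m / (E + p)| < 1.
  move=> p0; have Ep : 0 < E + p by rewrite ltr_wpDr.
  rewrite normrM normfV (gtr0_norm Ep) ltr_pdivrMr// mul1r.
  apply: (@lt_le_trans _ _ E); last by rewrite lerDl.
  rewrite -[ltRHS](gtr0_norm E0) -(ltr_pXn2r (ltn0Sn 1)) ?nnegrE//.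
  by rewrite !real_normK ?num_real//; move: (sqr_ge0 D) sE; rewrite -/D -/m -/E; lra.
have f0 : f 0 < 0.
  rewrite /f mul0r add0r addr0; have := mE 0 (lexx _); rewrite addr0 => v1.
  have t0 := lorentz_gt0 v1; have t2 := lorentz_sqr v1.
  set t := Num.sqrt _ in t0 t2 *.
  have EN0 := lt0r_neq0 E0.
  have DEt : D < E * t.
    rewrite -(ltr_pXn2r (ltn0Sn 1)) ?nnegrE ?mulr_ge0 ?(ltW D0) ?(ltW E0) ?(ltW t0)//.
    rewrite exprMn t2.
    have -> : E ^+ 2 * (1 - (m / E) ^+ 2) = E ^+ 2 - m ^+ 2 by field.
    by move: sE; rewrite -/D -/m -/E; lra.
  (* This turns [f 0] into [t * (D - E * t)], negative by [DEt]. *)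
  have -> : m ^+ 2 / E = E * (1 - t ^+ 2) by rewrite t2; field.
  have := mulr_gt0 (_ : 0 < E * t - D) t0; rewrite subr_gt0 => /(_ DEt); lra.
(* At this pressure the first term of [f] cancels [E], and the other two are nonnegative. *)
pose b := (gamma - 1) * E.
have b0 : 0 < b by rewrite mulr_gt0.
have fb : 0 <= f b.
  rewrite /f; have -> : b / (gamma - 1) = E by rewrite /b mulrC mulKf ?gt_eqF.
  set t := Num.sqrt _; have t0 : 0 <= t := sqrtr_ge0 _.
  have m0 : 0 <= m ^+ 2 / (E + b).
    by rewrite divr_ge0 ?sqr_ge0// addr_ge0// ltW.
  by have := mulr_ge0 (ltW D0) t0; rewrite -/D; lra.
have fc : {within `[0, b], continuous f}.
  apply: continuous_in_subspaceT => x; rewrite inE/= in_itv/= => /andP[x0 _].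
  have Ex : E + x != 0 by rewrite gt_eqF// ltr_wpDr.
  have cE : {for x, continuous (fun p : R => E + p)}.
    by apply: cvgD; [exact: cvg_cst|exact: cvg_id].
  have cV : {for x, continuous (fun p : R => (E + p)^-1)}.
    exact: cvgV.
  apply: cvgB; last exact: cvg_cst.
  apply: cvgD; first apply: cvgD.
  - by apply: cvgM; [exact: cvg_id|exact: cvg_cst].
  - by apply: cvgM; [exact: cvg_cst|exact: cV].
  - apply: cvgM; first exact: cvg_cst.
    apply: (@continuous_comp _ _ _ (fun p => 1 - (m / (E + p)) ^+ 2) Num.sqrt);
      last exact: sqrt_continuous.
    apply: cvgB; first exact: cvg_cst.
    by apply: cvgM; apply: cvgM; [exact: cvg_cst|exact: cV|exact: cvg_cst|exact: cV].
have [|p] := @IVT R f 0 b 0 (ltW b0) fc.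
  by rewrite ge_min le_max (ltW f0) fb orbT.
rewrite in_itv/= => /andP[p0 pb] fp.
have {}p0 : 0 < p.
  by rewrite lt_neqAle p0 andbT; apply/eqP => pE; move: f0; rewrite -[X in _ < X]fp -pE ltxx.
have Ep : 0 < E + p by rewrite addr_gt0.
have v1 := mE p (ltW p0); have t0 := lorentz_gt0 v1.
exists (D * Num.sqrt (1 - (m / (E + p)) ^+ 2), m / (E + p), p).
apply/is_primP => //; split=> //; first exact: mulr_gt0.
split=> //; first by rewrite mulrC divfK ?gt_eqF.
rewrite -/E; have -> : D * Num.sqrt (1 - (m / (E + p)) ^+ 2) =
   E - p / (gamma - 1) - m ^+ 2 / (E + p) by move: fp; rewrite /f; lra.
by field; rewrite !gt_eqF.
Qed.

End Primitive.

(** * Increment formula for the pressure *)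

Section PrimitiveRegularity.
Context {R : realType}.
Variable gamma : R.
Hypothesis hgamma : 1 < gamma <= 2.
Implicit Types (U : 'cV[R]_3) (rho v p : R).

Let gamma1 : 1 < gamma. Proof. by case/andP: hgamma. Qed.

Lemma invgamma_ge1 : 1 <= (gamma - 1)^-1.
Proof. by rewrite invf_ge1 ?subr_gt0//; move: hgamma; lra. Qed.

Lemma is_prim_enthalpy_gt0 U rho v p :
  is_prim gamma U (rho, v, p) -> 0 < ener U + p.
Proof.
move/(is_primP _ _ _ _ gamma1) => [r0 p0 v1 [_ _ e3]].
have v2 := sqr_lt1 v1; rewrite -(@pmulr_lgt0 _ (1 - v ^+ 2)) ?subr_gt0// e3.
by rewrite addr_gt0// mulr_gt0// divr_gt0 ?subr_gt0// (lt_trans _ gamma1).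
Qed.

(** Divided difference of the Lorentz root: for velocities below 1 in absolute value and
    [E + p != 0], multiplying by [(E + p) (v^2 - v0^2)] gives
    [D (sqrt (1 - v0^2) - sqrt (1 - v^2))]. *)
Definition chi (D E v0 v p : R) : R :=
  D / ((Num.sqrt (1 - v ^+ 2) + Num.sqrt (1 - v0 ^+ 2)) * (E + p)).

(** At [v = v0] and [X = chi D E v0 v0 p] this is the derivative in [p] of
    [p / (gamma - 1) + m v + D sqrt (1 - v^2)], where [v = m / (E + p)]. *)
Definition chord (X v0 v : R) : R :=
  (gamma - 1)^-1 - v0 * v + X * (v0 * (v + v0)).

(** With [t] and [s] the two roots, [D t = rho] is less than the enthalpy density [t^2 (E + p)];
    hence the quotient is below [t / (t + s)]. *)
Lemma chi_itv U rho v p v0 : is_prim gamma U (rho, v, p) -> `|v0| < 1 ->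
  0 < chi (dens U) (ener U) v0 v p < 1.
Proof.
move=> Up v01; have H0 := is_prim_enthalpy_gt0 Up; move: Up.
move/(is_primP _ _ _ _ gamma1) => [r0 p0 v1 [e1 _ e3]].
have t0 := lorentz_gt0 v1; have t00 := lorentz_gt0 v01.
have t2 := lorentz_sqr v1; rewrite /chi.
set t := Num.sqrt (1 - v ^+ 2) in e1 t0 t2 *.
set s := Num.sqrt (1 - v0 ^+ 2) in t00 *.
have D0 : 0 < dens U by rewrite -(pmulr_lgt0 _ t0) -e1.
have ts0 := addr_gt0 t0 t00.
rewrite divr_gt0 ?mulr_gt0//= ltr_pdivrMr ?mulr_gt0// mul1r.
have gp : 0 < gamma / (gamma - 1) * p.
  by rewrite mulr_gt0// divr_gt0 ?subr_gt0// (lt_trans _ gamma1).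
have : dens U < t * (ener U + p).
  rewrite -(ltr_pM2r t0) -e1.
  by have -> : t * (ener U + p) * t = (ener U + p) * (1 - v ^+ 2); [rewrite -t2; ring|lra].
have := mulr_gt0 t00 H0; lra.
Qed.

(** The constant term is at least 1 because [gamma <= 2]. The bound does not involve [v], so it is
    uniform before any continuity of the velocity is known. *)
Lemma chord_ge X v0 v : 0 < X < 1 -> `|v| < 1 -> `|v0| < 1 ->
  1 - `|v0| <= chord X v0 v.
Proof.
move=> /andP[X0 X1] v1 v01; rewrite /chord.
have h : v0 * v * (1 - X) <= `|v0|.
  apply: (le_trans (ler_norm _)); rewrite !normrM -[leRHS]mulr1 -mulrA.
  rewrite ler_wpM2l// -[leRHS]mulr1 ler_pM// ?ltW//.
  by rewrite ger0_norm ?subr_ge0 ?ltW//; lra.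
have := mulr_ge0 (ltW X0) (sqr_ge0 v0).
have := invgamma_ge1; lra.
Qed.

(* Both states satisfy E = m v + D sqrt(1 - v^2) + p / (gamma - 1). Subtracting
   and eliminating the difference of the velocities through m = (E + p) v leaves
   p - p0 as a linear form in the increments of (D, m, E) with coefficients that
   are bounded, and that are continuous once p is. *)
Lemma pressure_increment U U0 rho v p rho0 v0 p0 :
  is_prim gamma U (rho, v, p) -> is_prim gamma U0 (rho0, v0, p0) ->
  let X := chi (dens U) (ener U) v0 v p in
  (p - p0) * chord X v0 v =
  - ((dens U - dens U0) * Num.sqrt (1 - v0 ^+ 2) - (ener U - ener U0)
     + (mom U - mom U0) * v0
     + ((mom U - mom U0) - v0 * (ener U - ener U0)) * (v - X * (v + v0))).
Proof.
move=> Up Up0 X.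
have H0 := is_prim_enthalpy_gt0 Up; have H00 := is_prim_enthalpy_gt0 Up0.
have /(is_primP _ _ _ _ gamma1)[r_gt0 p_gt0 v1 [e1 e2 e3]] := Up.
have /(is_primP _ _ _ _ gamma1)[r0_gt0 p0_gt0 v01 [f1 f2 f3]] := Up0.
have t0 := lorentz_gt0 v1; have t00 := lorentz_gt0 v01.
have t2 := lorentz_sqr v1; have t02 := lorentz_sqr v01.
have hX : X * (ener U + p) *
    (Num.sqrt (1 - v ^+ 2) + Num.sqrt (1 - v0 ^+ 2)) = dens U.
  by rewrite /X /chi; field; rewrite !gt_eqF// addr_gt0.
rewrite /chord; move: hX e1 f1; move: X => X; move: t0 t00 t2 t02.
move: (Num.sqrt (1 - v ^+ 2)) (Num.sqrt (1 - v0 ^+ 2)) => t s t0 t00 t2 t02 hX e1 f1.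
have gk : gamma / (gamma - 1) = 1 + (gamma - 1)^-1.
  by field; rewrite gt_eqF// subr_gt0.
move: e3 f3; rewrite {}gk => e3 f3; rewrite e2 f2.
move: (gamma - 1)^-1 e3 f3 => k e3 f3.
have hX' : X * (ener U + p) * (v ^+ 2 - v0 ^+ 2) = dens U * (s - t).
  have -> : v ^+ 2 - v0 ^+ 2 = (t + s) * (s - t) by lra.
  by rewrite mulrA hX.
lra.
Qed.

Lemma primP U : admissible U -> is_prim gamma U (prim gamma U).
Proof. by move=> /(prim_exists hgamma); exact: xgetPex. Qed.

End PrimitiveRegularity.

(** * Differentiation by continuous slopes *)

Section Caratheodory.
Context {R : realType}.

Lemma mulmx_rV_norm_le (n m : nat) (C : R) (u : 'rV[R]_n) (M : 'M[R]_(n, m)) :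
  0 <= C -> (forall i j, `|M i j| <= C) -> `|u *m M| <= n%:R * C * `|u|.
Proof.
move=> C0 MC; rewrite [leLHS]/Num.Def.normr/= mx_normrE.
apply: bigmax_le => [|[i j] _]; first by rewrite !mulr_ge0.
rewrite /= mxE (le_trans (ler_norm_sum _ _ _))//.
rewrite -mulrA mulr_natl -[X in _ *+ X]card_ord -sumr_const.
apply: ler_sum => k _; rewrite normrM mulrC ler_pM//.
rewrite [leRHS]/Num.Def.normr/= mx_normrE.
exact: (@le_bigmax _ _ _ _ (fun ij => `|u ij.1 ij.2|) (i, k)).
Qed.

Lemma mulmxr_continuous (n m : nat) (M : 'M[R]_(n, m)) :
  continuous (mulmxr M : 'rV[R]_n -> 'rV[R]_m).
Proof.
apply: bounded_linear_continuous; apply/bounded_funP => r.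
pose C := \sum_i \sum_j `|M i j|.
have MC i j : `|M i j| <= C.
  rewrite /C (bigD1 i)//= (bigD1 j)//= -addrA lerDl.
  by rewrite addr_ge0 ?sumr_ge0// => k _; rewrite ?normr_ge0 ?sumr_ge0.
have C0 : 0 <= C by rewrite sumr_ge0// => i _; rewrite sumr_ge0.
exists (n%:R * C * r) => u ur; apply: le_trans (mulmx_rV_norm_le _ C0 MC) _.
by rewrite ler_wpM2l// mulr_ge0.
Qed.

(** The error of the linearization is [(u - a) *m (Phi u - Phi a)], hence of smaller order than
    [u - a]. *)
Lemma jacobian_slope (n m : nat) (f : 'rV[R]_n -> 'rV[R]_m)
    (Phi : 'rV[R]_n -> 'M[R]_(n, m)) (a : 'rV[R]_n) :
  (\forall u \near a, f u - f a = (u - a) *m Phi u) ->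
  (forall i j, (fun u => Phi u i j) @ a --> Phi a i j) ->
  jacobian f a = Phi a.
Proof.
move=> fPhi cPhi.
suff df : 'd f a = mulmxr (Phi a) :> (_ -> _).
  by apply/row_matrixP => i; rewrite !rowE /jacobian mul_rV_lin1 df.
apply: diff_unique; first exact: mulmxr_continuous.
apply/eqaddoP => _/posnumP[e].
(* [mulmx_rV_norm_le] costs a factor [n]; dividing by [n.+1] absorbs it and is safe for [n = 0]. *)
pose d := e%:num / n.+1%:R.
have d0 : 0 < d by rewrite divr_gt0.
have Pd : \forall u \near a, forall ij, `|Phi a ij.1 ij.2 - Phi u ij.1 ij.2| <= d.
  apply: (@filter_forall _ ('I_n * 'I_m)%type
    (fun ij u => `|Phi a ij.1 ij.2 - Phi u ij.1 ij.2| <= d) _ (nbhs_filter a)) => ij.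
  by have /cvgrPdist_le := cPhi ij.1 ij.2; apply.
have : \forall u \near a, `|f u - f a - (u - a) *m Phi a| <= e%:num * `|u - a|.
  near=> u.
  have -> : f u - f a = (u - a) *m Phi u by near: u.
  rewrite -mulmxBr (le_trans (@mulmx_rV_norm_le _ _ d _ _ (ltW d0) _))//.
    move=> i j; rewrite !mxE distrC; move: i j.
    suff h : forall ij, `|Phi a ij.1 ij.2 - Phi u ij.1 ij.2| <= d.
      by move=> i j; exact: (h (i, j)).
    by near: u.
  rewrite ler_wpM2r// /d mulrCA -[leRHS]mulr1 ler_wpM2l//.
  by rewrite ler_pdivrMr// mul1r ler_nat.
rewrite (near_shift 0) subr0; apply: filterS => u /=.
by rewrite addrK opprD addrA.
Unshelve. all: by end_near. Qed.

End Caratheodory.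

(** * Continuity of pressure and velocity *)

Section PrimitiveContinuity.
Context {R : realType}.
Variable gamma : R.
Hypothesis hgamma : 1 < gamma <= 2.

Let gamma1 : 1 < gamma. Proof. by case/andP: hgamma. Qed.

Lemma prim_components U : admissible U ->
  is_prim gamma U ((prim gamma U).1.1, (prim gamma U).1.2, (prim gamma U).2).
Proof. by move/(primP hgamma); case: prim => [[]]. Qed.

Lemma prim_vel_lt1 U : admissible U -> `|(prim gamma U).1.2| < 1.
Proof. by move/prim_components => /(is_primP _ _ _ _ gamma1)[]. Qed.

Lemma prim_enthalpy_gt0 U : admissible U -> 0 < ener U + (prim gamma U).2.
Proof. by move/prim_components/(is_prim_enthalpy_gt0 hgamma). Qed.

Lemma prim_velE U : admissible U ->
  (prim gamma U).1.2 = mom U / (ener U + (prim gamma U).2).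
Proof.
move=> aU; have H0 := prim_enthalpy_gt0 aU; move: (prim_components aU).
by case/(is_primP _ _ _ _ gamma1) => _ _ _ [_ -> _]; field; rewrite gt_eqF.
Qed.

Context {T : Type} {F : set_system T} {FF : Filter F}.
Variables (U : T -> 'cV[R]_3) (U0 : 'cV[R]_3).
Hypothesis admU0 : admissible U0.
Hypothesis cU : forall k, (fun x => U x k 0) @ F --> U0 k 0.

Local Notation D x := (dens (U x)).
Local Notation M x := (mom (U x)).
Local Notation E x := (ener (U x)).
Local Notation P x := (prim gamma (U x)).2.
Local Notation V x := (prim gamma (U x)).1.2.
Local Notation v0 := (prim gamma U0).1.2.
Local Notation p0 := (prim gamma U0).2.

Lemma cvg_sqrt (f : T -> R) l :
  f @ F --> l -> (fun x => Num.sqrt (f x)) @ F --> Num.sqrt l.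
Proof. by move=> fl; apply: (cvg_comp f Num.sqrt fl); exact: sqrt_continuous. Qed.

Lemma cvg_absdist (f : T -> R) l :
  f @ F --> l -> (fun x => `|f x - l|) @ F --> (0 : R).
Proof.
move=> fl; rewrite -(@normr0 _ R) -(subrr l); apply: cvg_norm.
by apply: cvgB => //; exact: cvg_cst.
Qed.

Lemma cvg_dens : (fun x => D x) @ F --> dens U0. Proof. exact: cU. Qed.
Lemma cvg_mom : (fun x => M x) @ F --> mom U0. Proof. exact: cU. Qed.
Lemma cvg_ener : (fun x => E x) @ F --> ener U0. Proof. exact: cU. Qed.

Lemma admissible_near : \forall x \near F, admissible (U x).
Proof.
have [D0 g0] := admU0.
have cg : (fun x => gfun (U x)) @ F --> gfun U0.
  rewrite /gfun; apply: cvgB; first exact: cvg_ener.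
  apply: cvg_sqrt; apply: cvgD.
    by apply: cvgM; exact: cvg_dens.
  by apply: cvgM; exact: cvg_mom.
near=> x; split.
  by near: x; exact: (cvgr_gt _ cvg_dens).
by near: x; exact: (cvgr_gt _ cg).
Unshelve. all: by end_near. Qed.

Let v0_lt1 : `|v0| < 1. Proof. exact: prim_vel_lt1. Qed.
Let H0_gt0 : 0 < ener U0 + p0. Proof. exact: prim_enthalpy_gt0. Qed.

Local Notation X x := (chi (D x) (E x) v0 (V x) (P x)).
Local Notation B x := (chord gamma (X x) v0 (V x)).

(** The coefficients in [pressure_increment] are so far only known to be bounded, which suffices for
    a squeeze; continuity of the velocity is then deduced from that of the pressure. *)
Lemma cvg_prim_pressure : (fun x => P x) @ F --> p0.
Proof.
have c0 : 0 < 1 - `|v0| by rewrite subr_gt0.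
(* The factor 4 is [1 + 3]: 1 for the increments outside the product with [G], 3 for the bound
   [G3]. *)
pose e x := (1 - `|v0|)^-1 *
  (`|D x - dens U0| + 4 * (`|M x - mom U0| + `|E x - ener U0|)).
have e0 : e @ F --> 0.
  have -> : 0 = (1 - `|v0|)^-1 * (0 + 4 * (0 + 0)) :> R by rewrite !(addr0, mulr0).
  apply: cvgM; first exact: cvg_cst.
  apply: cvgD; first exact/cvg_absdist/cvg_dens.
  apply: cvgM; first exact: cvg_cst.
  by apply: cvgD; [exact/cvg_absdist/cvg_mom|exact/cvg_absdist/cvg_ener].
apply: cvg_zero; apply: norm_cvg0.
apply: (@squeeze_cvgr _ _ _ _ (cst 0) e) => //; last exact: cvg_cst.
near=> x; rewrite /= normr_ge0 /=.
have uG : admissible (U x) by near: x; exact: admissible_near.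
have := pressure_increment hgamma (prim_components uG) (prim_components admU0).
have v1 := prim_vel_lt1 uG.
have Xitv := chi_itv hgamma (prim_components uG) v0_lt1.
have Bge := chord_ge hgamma Xitv v1 v0_lt1.
move: Xitv Bge; rewrite /=; set y := chi _ _ _ _ _; set b := chord _ _ _ _.
move=> /andP[X0 X1] Bge pB.
rewrite /e mulrC ler_pdivlMr//. 
apply: (@le_trans _ _ (`|P x - p0| * b)); first by rewrite ler_wpM2l.
have B0 : 0 < b by exact: lt_le_trans Bge.
rewrite -[Z in _ * Z](gtr0_norm B0) -normrM {}pB normrN.
have t1 : Num.sqrt (1 - v0 ^+ 2) <= 1.
  by rewrite -[leRHS]sqrtr1 ler_wsqrtr// gerBl sqr_ge0.
have t0 := lorentz_gt0 v0_lt1.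
set s := Num.sqrt _ in t0 t1 *.
have G3 : `|V x - y * (V x + v0)| <= 3.
  rewrite (le_trans (ler_normB _ _))// normrM (gtr0_norm X0).
  have := ler_wpM2r (normr_ge0 (V x + v0)) (ltW X1).
  have := ler_normD (V x) v0; move: v1 v0_lt1; lra.
set G := V x - _ in G3 *; set d := D x - _; set m := M x - _; set en := E x - _.
rewrite (le_trans (ler_normD _ _))// (le_trans (lerD (ler_normD _ _) (lexx _)))//.
rewrite (le_trans (lerD (lerD (ler_normB _ _) (lexx _)) (lexx _)))//.
rewrite !normrM (gtr0_norm t0).
have h1 : `|d| * s <= `|d| by rewrite ler_piMr.
have h2 : `|m| * `|v0| <= `|m| by rewrite ler_piMr// ltW.
have h3 : `|m - v0 * en| * `|G| <= (`|m| + `|en|) * 3.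
  apply: ler_pM => //; rewrite (le_trans (ler_normB _ _))// lerD2l normrM.
  by rewrite ler_piMl// ltW.
lra.
Unshelve. all: by end_near. Qed.

Lemma cvg_prim_vel : (fun x => V x) @ F --> v0.
Proof.
have ev : {near F, (fun x => M x / (E x + P x)) =1 (fun x => V x)}.
  by apply: filterS admissible_near => x /prim_velE.
apply: (cvg_trans (near_eq_cvg ev)); rewrite (prim_velE admU0).
apply: cvgM; first exact: cvg_mom.
apply: cvgV; first by rewrite gt_eqF.
by apply: cvgD; [exact: cvg_ener|exact: cvg_prim_pressure].
Qed.

Lemma cvg_chi : (fun x => X x) @ F --> chi (dens U0) (ener U0) v0 v0 p0.
Proof.
have t0 := lorentz_gt0 v0_lt1.
rewrite /chi; apply: cvgM; first exact: cvg_dens.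
apply: cvgV; first by rewrite mulf_neq0// gt_eqF// addr_gt0.
apply: cvgM.
  apply: cvgD; last exact: cvg_cst.
  apply: cvg_sqrt; apply: cvgB; first exact: cvg_cst.
  by apply: cvgM; exact: cvg_prim_vel.
by apply: cvgD; [exact: cvg_ener|exact: cvg_prim_pressure].
Qed.

Lemma cvg_chord : (fun x => B x) @ F -->
  chord gamma (chi (dens U0) (ener U0) v0 v0 p0) v0 v0.
Proof.
rewrite /chord; apply: cvgD.
  apply: cvgB; first exact: cvg_cst.
  by apply: cvgM; [exact: cvg_cst|exact: cvg_prim_vel].
apply: cvgM; first exact: cvg_chi.
apply: cvgM; first exact: cvg_cst.
by apply: cvgD; [exact: cvg_prim_vel|exact: cvg_cst].
Qed.

End PrimitiveContinuity.

(** * The Jacobian of the flux *)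

Section FluxJacobian.
Context {R : realType}.

(* With f the slopes of the pressure and n those of the velocity, the slopes of
   D v, m v + p and m in the directions D, m, E. *)
Definition slope_mx (D0 m0 v0 s v H G b : R) : 'M[R]_3 :=
  let f := [:: - s / b; - (v0 + G) / b; (1 + v0 * G) / b] in
  let n := [:: - v0 * f`_0 / H; (1 - v0 * f`_1) / H; - v0 * (1 + f`_2) / H] in
  \matrix_(i < 3, j < 3)
    [:: [:: v + D0 * n`_0; m0 * n`_0 + f`_0; 0]`_j;
        [:: D0 * n`_1; v + m0 * n`_1 + f`_1; 1]`_j;
        [:: D0 * n`_2; m0 * n`_2 + f`_2; 0]`_j]`_i.

Lemma cvg_slope_mx (T : Type) (F : set_system T) (FF : Filter F)
    (D0 m0 v0 s v0' H0 G0 b0 : R) (v H G b : T -> R) (i j : 'I_3) :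
  v @ F --> v0' -> H @ F --> H0 -> G @ F --> G0 -> b @ F --> b0 ->
  H0 != 0 -> b0 != 0 ->
  (fun x => slope_mx D0 m0 v0 s (v x) (H x) (G x) (b x) i j) @ F -->
  slope_mx D0 m0 v0 s v0' H0 G0 b0 i j.
Proof.
move=> cv cH cG cb HN0 bN0.
have cc (c : R) : (fun _ : T => c) @ F --> c by exact: cvg_cst.
have cbV : (fun x => (b x)^-1) @ F --> b0^-1 by exact: cvgV.
have cHV : (fun x => (H x)^-1) @ F --> H0^-1 by exact: cvgV.
have cf0 : (fun x => - s / b x) @ F --> - s / b0 by apply: cvgM.
have cf1 : (fun x => - (v0 + G x) / b x) @ F --> - (v0 + G0) / b0.
  by apply: cvgM => //; apply: cvgN; apply: cvgD.
have cf2 : (fun x => (1 + v0 * G x) / b x) @ F --> (1 + v0 * G0) / b0.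
  by apply: cvgM => //; apply: cvgD => //; apply: cvgM.
have cn0 : (fun x => - v0 * (- s / b x) / H x) @ F --> - v0 * (- s / b0) / H0.
  by apply: cvgM => //; apply: cvgM.
have cn1 : (fun x => (1 - v0 * (- (v0 + G x) / b x)) / H x) @ F -->
    (1 - v0 * (- (v0 + G0) / b0)) / H0.
  by apply: cvgM => //; apply: cvgB => //; apply: cvgM.
have cn2 : (fun x => - v0 * (1 + (1 + v0 * G x) / b x) / H x) @ F -->
    - v0 * (1 + (1 + v0 * G0) / b0) / H0.
  by apply: cvgM => //; apply: cvgM => //; apply: cvgD.
rewrite mxE; under eq_cvg do rewrite mxE.
case: i => [[|[|[|//]]]] ?; case: j => [[|[|[|//]]]] ? /=; try exact: cc.
- by apply: cvgD => //; apply: cvgM.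
- by apply: cvgD => //; apply: cvgM.
- by apply: cvgM.
- by apply: cvgD => //; apply: cvgD => //; apply: cvgM.
- by apply: cvgM.
- by apply: cvgD => //; apply: cvgM.
Qed.

Variable gamma : R.
Hypothesis hgamma : 1 < gamma <= 2.

Let gamma1 : 1 < gamma. Proof. by case/andP: hgamma. Qed.

Lemma fluxE U : flux gamma U =
  mk3 (dens U * (prim gamma U).1.2)
      (mom U * (prim gamma U).1.2 + (prim gamma U).2) (mom U).
Proof. by rewrite /flux; case: prim => [[]]. Qed.

Definition flux_slope (U0 U : 'cV[R]_3) : 'M[R]_3 :=
  let v0 := (prim gamma U0).1.2 in
  let v := (prim gamma U).1.2 in
  let p := (prim gamma U).2 in
  let X := chi (dens U) (ener U) v0 v p in
  slope_mx (dens U0) (mom U0) v0 (Num.sqrt (1 - v0 ^+ 2)) v (ener U + p)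
    (v - X * (v + v0)) (chord gamma X v0 v).

Lemma chord_gt0 U0 U : admissible U0 -> admissible U ->
  0 < chord gamma (chi (dens U) (ener U) (prim gamma U0).1.2
        (prim gamma U).1.2 (prim gamma U).2)
      (prim gamma U0).1.2 (prim gamma U).1.2.
Proof.
move=> aU0 aU; have v01 := prim_vel_lt1 hgamma aU0.
apply: lt_le_trans (chord_ge hgamma _ (prim_vel_lt1 hgamma aU) v01).
  by rewrite subr_gt0.
exact: chi_itv (prim_components hgamma aU) v01.
Qed.

Lemma flux_increment U0 U : admissible U0 -> admissible U ->
  (flux gamma U)^T - (flux gamma U0)^T = (U^T - U0^T) *m flux_slope U0 U.
Proof.
move=> aU0 aU.
have b0 := chord_gt0 aU0 aU; have H0 := prim_enthalpy_gt0 hgamma aU.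
have := pressure_increment hgamma (prim_components hgamma aU)
  (prim_components hgamma aU0).
have /(is_primP _ _ _ _ gamma1)[_ _ _ [_ e2 _]] := prim_components hgamma aU.
have /(is_primP _ _ _ _ gamma1)[_ _ _ [_ f2 _]] := prim_components hgamma aU0.
move: b0; rewrite /= !fluxE /flux_slope.
move: (prim gamma U).1.2 (prim gamma U).2 (prim gamma U0).1.2 (prim gamma U0).2
  H0 e2 f2 => v p v0 p0 H0 e2 f2.
move: (Num.sqrt _) => s; set X := chi _ _ _ _ _; set b := chord _ _ _ _.
set G := v - X * (v + v0); move=> b0.
set phi := (X in _ = - X) => pB.
have pE : p - p0 = - phi / b by rewrite -pB mulfK// gt_eqF.
(* Since [m = (E + p) v] in both states, [(E + p) (v - v0)] is the increment of [m] minus [v0] times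
   that of [E + p]. *)
have vE : v - v0 = ((mom U - mom U0) - v0 * ((ener U - ener U0) + (p - p0))) /
    (ener U + p).
  apply: (mulIf (lt0r_neq0 H0)); rewrite divfK ?gt_eqF// e2 f2; ring.
apply/rowP => j; rewrite !mxE !big_ord_recl big_ord0 !mxE /=.
have -> : lift ord0 ord0 = 1 :> 'I_3 by exact/val_inj.
have -> : lift ord0 (lift ord0 ord0) = 2 :> 'I_3 by exact/val_inj.
rewrite -/(dens U) -/(dens U0) -/(mom U) -/(mom U0) -/(ener U) -/(ener U0).
clearbody b G; case: j => [[|[|[|//]]]] ? /=.
- have -> : dens U * v - dens U0 * v0 =
    (dens U - dens U0) * v + dens U0 * (v - v0) by ring.
  by rewrite vE pE /phi; field; rewrite !gt_eqF.
- have -> : mom U * v + p - (mom U0 * v0 + p0) =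
    (mom U - mom U0) * v + mom U0 * (v - v0) + (p - p0) by ring.
  by rewrite vE pE /phi; field; rewrite !gt_eqF.
- by ring.
Qed.

Lemma cvg_flux_slope (T : Type) (F : set_system T) (FF : Filter F)
    (U : T -> 'cV[R]_3) (U0 : 'cV[R]_3) (i j : 'I_3) : admissible U0 ->
  (forall k, (fun x => U x k 0) @ F --> U0 k 0) ->
  (fun x => flux_slope U0 (U x) i j) @ F --> flux_slope U0 U0 i j.
Proof.
move=> aU0 cU; have b0 := chord_gt0 aU0 aU0.
have H0 := prim_enthalpy_gt0 hgamma aU0.
have cv := @cvg_prim_vel _ _ hgamma _ _ FF _ _ aU0 cU.
apply: cvg_slope_mx => //; rewrite ?gt_eqF//.
- apply: cvgD; first exact: cvg_ener.
  exact: cvg_prim_pressure.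
- apply: cvgB => //; apply: cvgM; first exact: cvg_chi.
  by apply: cvgD => //; exact: cvg_cst.
- exact: cvg_chord.
Qed.

(** Admissibility persists near [U0], so [flux_increment] holds in a whole neighbourhood, as
    [jacobian_slope] requires. *)
Lemma flux_jacE U0 : admissible U0 ->
  flux_jac gamma U0 = (flux_slope U0 U0)^T.
Proof.
move=> aU0; rewrite /flux_jac; congr (_^T).
have cU k : (fun u : 'rV[R]_3 => u^T k 0) @ U0^T --> U0 k 0.
  have -> : U0 k 0 = U0^T 0 k by rewrite mxE.
  rewrite (_ : (fun u : 'rV[R]_3 => u^T k 0) = (fun u => u 0 k)).
    exact: coord_continuous.
  by apply/funext => u; rewrite mxE.
have := @jacobian_slope _ _ _ (fun u => (flux gamma u^T)^T)
  (fun u => flux_slope U0 u^T) U0^T; rewrite trmxK; apply.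
  have := @admissible_near _ _ _ (nbhs_filter U0^T) _ _ aU0 cU.
  by apply: filterS => u au; rewrite flux_increment// trmxK.
move=> i j.
exact: (@cvg_flux_slope _ _ (nbhs_filter U0^T) trmx U0 i j aU0 cU).
Qed.

End FluxJacobian.

(** * Real eigenvalues and the spectral radius *)

Section SpectralRadius.
Context {R : realType}.

Lemma normc_real (x : R) : ComplexField.Normc.normc (real_complex R x) = `|x|.
Proof. by rewrite /= expr0n addr0 sqrtr_sqr. Qed.

(** [sup] dominates the members of a set that is bounded above; the spectrum is one, since it
    consists of the finitely many roots of the characteristic polynomial. *)
Lemma spectral_radius_ge (n : nat) (A : 'M[R]_n) (x : R) :
  eigenvalue A x -> `|x| <= spectral_radius A.
Proof.
move=> Ax; apply: ub_le_sup; last first.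
  by exists (real_complex R x); rewrite ?normc_real//= eigenvalue_map.
have [rs rsE] := closed_field_poly_normal (char_poly (map_mx (real_complex R) A)).
exists (\big[Num.max/0]_(z <- rs) ComplexField.Normc.normc z) => _ [z /= Az <-].
apply: le_bigmax_seq => //; move: Az; rewrite eigenvalue_root_char rsE rootZ.
  by rewrite root_prod_XsubC.
by rewrite lead_coef_eq0 -size_poly_gt0 size_char_poly.
Qed.

(** [eigenvalue] refers to row vectors, and [flux_jac] is the transpose of the slope matrix;
    determinants do not see the transposition. *)
Lemma eigenvalue_trmx (n : nat) (A : 'M[R]_n) (x : R) (r : 'rV[R]_n) :
  r != 0 -> r *m A = x *: r -> eigenvalue A^T x.
Proof.
move=> r0 rA.
have : \det (A - x%:M) == 0.
  by apply/det0P; exists r => //; rewrite mulmxBr rA mul_mx_scalar subrr.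
rewrite -det_tr linearB/= tr_scalar_mx => /det0P[v v0 /eqP].
rewrite mulmxBr mul_mx_scalar subr_eq0 => /eqP vA.
by apply/eigenvalueP; exists v.
Qed.

End SpectralRadius.

(** * Acoustic eigenvalues of the flux Jacobian *)

Section SoundWaves.
Context {R : realType}.

(* Scaled acoustic eigenvector of the relativistic Euler equations; here c is
   the sound speed up to sign, k = 1 / (gamma - 1), w = rho h and rho = w q. *)
Lemma acoustic_eigenvector (k w c v s : R) :
  k != 0 -> w != 0 -> s != 0 -> 1 - (v * c) ^+ 2 != 0 -> 1 + v * c != 0 ->
  s ^+ 2 = 1 - v ^+ 2 ->
  let q := 1 - k * c ^+ 2 in
  let r := \row_(j < 3) [:: s * q; v + c; 1 + v * c]`_j in
  r *m slope_mx (w * q / s) (w / s ^+ 2 * v) v s v (w / s ^+ 2)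
      (k * c ^+ 2 * v) (k * (1 - (v * c) ^+ 2)) =
  ((v + c) / (1 + v * c)) *: r.
Proof.
move=> k0 w0 s0 vc0 vc1 s2 q r; set b := k * (1 - _).
have b0 : b != 0 by rewrite /b mulf_neq0.
have vN0 : 1 - v ^+ 2 != 0 by rewrite -s2 expf_neq0.
apply/rowP => j; rewrite !mxE !big_ord_recl big_ord0 !mxE /=.
case: j => [[|[|[|//]]]] ? /=.
- have -> : w * q / s * (- v * (- s / b) / (w / s ^+ 2)) = q * v * s ^+ 2 / b.
    by field; rewrite s0 b0.
  have -> : w * q / s = w * q * s / s ^+ 2 by field.
  by rewrite s2 /b /q; field; rewrite k0 w0 vc0 vc1 vN0.
- have -> : s * q * (w / s ^+ 2 * v * (- v * (- s / b) / (w / s ^+ 2)) + - s / b) =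
    - q * s ^+ 2 * s ^+ 2 / b + q * s ^+ 2 * (s ^+ 2 - (1 - v ^+ 2)) / b.
    by field; rewrite s0 w0 b0.
  by rewrite s2 /b /q; field; rewrite k0 w0 vc0 vc1 vN0.
- by field.
Qed.

Variable gamma : R.
Hypothesis hgamma : 1 < gamma <= 2.

Let gamma1 : 1 < gamma. Proof. by case/andP: hgamma. Qed.

Definition enthalpy_density (rho p : R) : R := rho + gamma / (gamma - 1) * p.

Lemma enthalpy_density_gt (rho p : R) :
  0 < rho -> 0 < p -> rho + gamma * p <= enthalpy_density rho p.
Proof.
move=> r0 p0; rewrite /enthalpy_density lerD2l ler_pM2r//.
by rewrite ler_pMr ?(lt_trans _ gamma1)// invgamma_ge1.
Qed.

(** The squared sound speed is [gamma p / (rho h)], and [rho h] exceeds [gamma p] by at least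
    [rho]. *)
Lemma sound_speed_lt1 (rho p c : R) : 0 < rho -> 0 < p ->
  c ^+ 2 * enthalpy_density rho p = gamma * p -> `|c| < 1.
Proof.
move=> r0 p0 hc; have w1 := enthalpy_density_gt r0 p0.
have gp : 0 < gamma * p by rewrite mulr_gt0// (lt_trans _ gamma1).
rewrite -(expr_lt1 (ltn0Sn 1)) ?real_normK ?num_real ?normr_ge0//.
have w0 : 0 < enthalpy_density rho p by lra.
rewrite -(ltr_pM2r w0) hc mul1r; lra.
Qed.

(** At coinciding states the slope matrix takes the form treated in [acoustic_eigenvector]. Only the
    square of [c] is prescribed, so both acoustic waves are covered. *)
Lemma flux_jac_eigenvalue U rho v p c : admissible U ->
  prim gamma U = (rho, v, p) ->
  c ^+ 2 * enthalpy_density rho p = gamma * p ->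
  eigenvalue (flux_jac gamma U) ((v + c) / (1 + v * c)).
Proof.
move=> aU pU hc; have := prim_components hgamma aU; rewrite pU /=.
move=> /(is_primP _ _ _ _ gamma1)[r0 p0 v1 [e1 e2 e3]].
have t0 := lorentz_gt0 v1; have t2 := lorentz_sqr v1.
have c1 := sound_speed_lt1 r0 p0 hc.
have w0 : 0 < enthalpy_density rho p.
  apply: lt_le_trans (enthalpy_density_gt r0 p0).
  by rewrite addr_gt0// mulr_gt0// (lt_trans _ gamma1).
have vc1 : `|v * c| < 1 by rewrite normrM mulr_ilt1.
have k0 : 0 < (gamma - 1)^-1 by rewrite invr_gt0 subr_gt0.
rewrite flux_jacE// /flux_slope pU /= /chi /chord.
move: e1 t0 t2; move: (Num.sqrt _) => s e1 t0 t2.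
move: e3; rewrite -/(enthalpy_density rho p) -t2.
(* By [hc], [c ^+ 2 / (gamma - 1)] is the fraction of the enthalpy density due to pressure. *)
have rE : rho = enthalpy_density rho p * (1 - (gamma - 1)^-1 * c ^+ 2).
  have -> : enthalpy_density rho p * (1 - (gamma - 1)^-1 * c ^+ 2) =
    enthalpy_density rho p - (gamma - 1)^-1 * (c ^+ 2 * enthalpy_density rho p) by ring.
  by rewrite hc /enthalpy_density; ring.
move: (enthalpy_density rho p) w0 rE hc => w w0 rE hc e3.
have sN0 := lt0r_neq0 t0; have wN0 := lt0r_neq0 w0.
have gN0 : gamma - 1 != 0 by rewrite gt_eqF// subr_gt0.
set k := (gamma - 1)^-1 in k0 rE *; have kN0 := lt0r_neq0 k0.
have HE : ener U + p = w / s ^+ 2 by rewrite -e3 mulfK// expf_neq0.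
have DE : dens U = w * (1 - k * c ^+ 2) / s by rewrite -rE e1 mulfK.
rewrite e2 {}HE {}DE.
have -> : w * (1 - k * c ^+ 2) / s / ((s + s) * (w / s ^+ 2)) =
    (1 - k * c ^+ 2) / 2.
  by field; rewrite sN0 wN0 -mulr2n mulrn_eq0.
have -> : v - (1 - k * c ^+ 2) / 2 * (v + v) = k * c ^+ 2 * v by field.
have -> : k - v * v + (1 - k * c ^+ 2) / 2 * (v * (v + v)) =
    k * (1 - (v * c) ^+ 2) by field.
have vc1' : 0 < 1 + v * c by move: vc1; rewrite ltr_norml => /andP[]; lra.
apply: eigenvalue_trmx (acoustic_eigenvector kN0 wN0 sN0 _ (lt0r_neq0 vc1') t2).
  apply/eqP => /rowP/(_ 2); rewrite !mxE /= => h; move: vc1'; rewrite h ltxx//.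
by rewrite gt_eqF// subr_gt0 sqr_lt1.
Qed.

(** Of the two acoustic eigenvalues, the one whose sound speed has the sign of [v] is used, so that
    the speeds add up in absolute value. *)
Lemma rho1_ge U rho v p c : admissible U -> prim gamma U = (rho, v, p) ->
  0 <= c -> c ^+ 2 * enthalpy_density rho p = gamma * p ->
  `|v| + c <= rho1 gamma U * (1 + `|v| * c).
Proof.
move=> aU pU c0 hc; have := prim_components hgamma aU; rewrite pU /=.
move=> /(is_primP _ _ _ _ gamma1)[r0 p0 v1 _].
have vc0 : 0 < 1 + `|v| * c by rewrite ltr_wpDr// mulr_ge0.
rewrite -ler_pdivrMr//.
have [v_le0|v_gt0] := ler0P v; last first.
  have := spectral_radius_ge (flux_jac_eigenvalue aU pU hc).
  rewrite -/(rho1 _ _); apply: le_trans; exact: ler_norm.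
have hc' : (- c) ^+ 2 * enthalpy_density rho p = gamma * p by rewrite sqrrN.
have := spectral_radius_ge (flux_jac_eigenvalue aU pU hc').
rewrite -/(rho1 _ _); apply: le_trans; rewrite mulrN mulNr.
by rewrite -[- v + c]opprK opprD !opprK [- (v - c) / _]mulNr -normrN; exact: ler_norm.
Qed.

End SoundWaves.

(** * Admissibility of the Lax--Friedrichs split states *)

Section LaxFriedrichsSplitting.
Context {R : realType}.
Variable gamma : R.
Hypothesis hgamma : 1 < gamma <= 2.

Let gamma1 : 1 < gamma. Proof. by case/andP: hgamma. Qed.

(** The difference of squares factors into two expressions affine in [a], with positive slopes
    [1 - c x] and [1 + c x]; the lower bound on [a], a relativistic sum of speeds, makes both
    nonnegative. *)
Lemma sound_cone (a c x : R) : 0 < c < 1 -> `|x| < 1 ->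
  `|x| + c <= a * (1 + `|x| * c) ->
  0 < a + x /\ c ^+ 2 * (1 + x * a) ^+ 2 <= (a + x) ^+ 2.
Proof.
move=> /andP[c0 c1] x1 ha; set y := `|x| in x1 ha.
have y0 : 0 <= y := normr_ge0 x.
have yc0 : 0 < 1 + y * c by rewrite ltr_wpDr// mulr_ge0// ltW.
have y2 : 0 < 1 - y ^+ 2 by rewrite subr_gt0 expr_lt1.
have c2 : 0 < 1 - c ^+ 2 by rewrite subr_gt0 expr_lt1// ltW.
have ay : y < a.
  rewrite -(ltr_pM2r yc0); apply: lt_le_trans ha.
  have := mulr_gt0 c0 y2; lra.
have xy : - y <= x <= y by rewrite -ler_norml.
have q0 : 0 < a + x by lra.
split=> //; rewrite -exprMn -subr_ge0 subr_sqr.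
have [xy1 xy2] := andP xy.
have cx : - 1 <= c * x <= 1.
  by rewrite -ler_norml normrM mulr_ile1// ltW// ger0_norm// ltW.
have [cx1 cx2] := andP cx.
have ha1 : (y + c) * (1 - c * x) <= a * (1 + y * c) * (1 - c * x).
  by rewrite ler_wpM2r// subr_ge0.
have ha2 : (y + c) * (1 + c * x) <= a * (1 + y * c) * (1 + c * x).
  by rewrite ler_wpM2r// -lerBlDl sub0r.
have xy0 : 0 <= x + y by lra.
apply: mulr_ge0; rewrite -(pmulr_lge0 _ yc0).
  have := mulr_ge0 xy0 (ltW c2).
  by lra.
have := mulr_ge0 xy0 (addr_ge0 ler01 (sqr_ge0 c)).
have := mulr_ge0 (mulr_ge0 (ltW c0) xy0) y0.
have := mulr_gt0 c0 y2.
lra.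
Qed.

(* With w = rho h and k = 1 / (gamma - 1) this is the dominant energy condition
   w - p > p / c, refined by the rest mass; the bound gamma <= 2 enters as 1 <= k. *)
Lemma sound_energy_bound (k rho p c q0 q1 : R) :
  1 <= k -> 0 < rho -> 0 < p -> 0 < c -> 0 < q0 ->
  c ^+ 2 * (k * (rho + (1 + k) * p)) = (1 + k) * p ->
  c ^+ 2 * q1 ^+ 2 <= q0 ^+ 2 ->
  p ^+ 2 * q1 ^+ 2 < ((rho + k * p) ^+ 2 - rho ^+ 2) * q0 ^+ 2.
Proof.
move=> k1 r0 p0 c0 q00 hc cq.
have c20 : 0 < c ^+ 2 by rewrite exprn_gt0.
have w0 : 0 < k * (rho + (1 + k) * p).
  by rewrite mulr_gt0 ?addr_gt0 ?mulr_gt0//; lra.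
have key : p ^+ 2 < c ^+ 2 * ((rho + k * p) ^+ 2 - rho ^+ 2).
  rewrite -(ltr_pM2r w0) [ltRHS]mulrAC hc.
  (* Cancelling [p^2 k] leaves [rho + (1 + k) p < (1 + k) (2 rho + k p)], where the pressure terms
     compare because [1 <= k]. *)
  have -> : (1 + k) * p * ((rho + k * p) ^+ 2 - rho ^+ 2) =
     p ^+ 2 * k * ((1 + k) * (2 * rho + k * p)) by ring.
  rewrite [ltLHS]mulrA ltr_pM2l ?mulr_gt0 ?exprn_gt0//; last lra.
  have := mulr_gt0 r0 p0; have := mulr_ge0 (_ : 0 <= k - 1) (ltW r0).
  have := mulr_ge0 (_ : 0 <= k - 1) (ltW p0).
  have := mulr_ge0 (_ : 0 <= k * (k - 1)) (ltW p0).
  rewrite subr_ge0 => h1 h2 h3 h4.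
  have kk : 0 <= k * (k - 1) by rewrite mulr_ge0 ?subr_ge0//; lra.
  move: (h1 kk) (h2 k1) (h3 k1); lra.
rewrite -(ltr_pM2l c20).
apply: (@le_lt_trans _ _ (p ^+ 2 * q0 ^+ 2)).
  by rewrite mulrCA ler_wpM2l ?sqr_ge0.
by rewrite [ltRHS]mulrA ltr_pM2r// exprn_gt0.
Qed.

Lemma lax_friedrichs_splitting U (a sg : R) : sg ^+ 2 = 1 -> admissible U ->
  rho1 gamma U <= a -> admissible (a *: U + sg *: flux gamma U).
Proof.
move=> sg2 aU ha; have := prim_components hgamma aU.
have pE : prim gamma U = ((prim gamma U).1.1, (prim gamma U).1.2, (prim gamma U).2).
  by case: prim => [[]].
rewrite fluxE; move: pE.
move: (prim gamma U).1.1 (prim gamma U).1.2 (prim gamma U).2 => rho v p pE.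
case/(is_primP _ _ _ _ gamma1) => r0 p0 v1 [e1 e2 e3].
have t0 := lorentz_gt0 v1; have t2 := lorentz_sqr v1.
move: (Num.sqrt _) t0 t2 e1 => t t0 t2 e1.
pose k := (gamma - 1)^-1; have k1 : 1 <= k := invgamma_ge1 hgamma.
have gN0 : gamma - 1 != 0 by rewrite gt_eqF// subr_gt0.
have kN0 : k != 0 by rewrite gt_eqF// (lt_le_trans _ k1).
have gE : gamma = (1 + k) / k by rewrite /k; field.
have wE : enthalpy_density gamma rho p = rho + (1 + k) * p.
  by rewrite /enthalpy_density /k; field.
have w0 : 0 < rho + (1 + k) * p by rewrite addr_gt0// mulr_gt0//; lra.
pose c := Num.sqrt (gamma * p / (rho + (1 + k) * p)).
have gp0 : 0 < gamma * p by rewrite mulr_gt0// (lt_trans _ gamma1).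
have c0 : 0 < c by rewrite sqrtr_gt0 divr_gt0.
have hc : c ^+ 2 * enthalpy_density gamma rho p = gamma * p.
  by rewrite wE sqr_sqrtr ?divfK ?gt_eqF// ltW// divr_gt0.
have c1 : 0 < c < 1.
  by rewrite c0 -(gtr0_norm c0) (sound_speed_lt1 hgamma r0 p0 hc).
have := rho1_ge hgamma aU pE (ltW c0) hc => hr.
have sg1 : `|sg| = 1.
  by apply/eqP; rewrite -sqrp_eq1 ?normr_ge0// real_normK ?num_real// sg2.
(* As [sg] is 1 or -1, reflecting the velocity treats both splittings at once. *)
pose x := sg * v; have xv : `|x| = `|v| by rewrite normrM sg1 mul1r.
have [||q0 cone] := @sound_cone a c x c1; rewrite ?xv//.
  by apply: le_trans hr _; rewrite ler_wpM2r// addr_ge0// mulr_ge0// ltW.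
have hc' : c ^+ 2 * (k * (rho + (1 + k) * p)) = (1 + k) * p.
  by rewrite -wE mulrCA hc gE; field.
have := sound_energy_bound k1 r0 p0 c0 q0 hc' cone.
move: e3; rewrite -/(enthalpy_density gamma rho p) wE -t2 => e3.
have x2 : x ^+ 2 = v ^+ 2 by rewrite exprMn sg2 mul1r.
set q := a + x in q0 *; set q1 := 1 + x * a => energy.
have tN0 := lt0r_neq0 t0.
have HE : ener U + p = (rho + (1 + k) * p) / t ^+ 2.
  by rewrite -e3 mulfK// expf_neq0.
have DE : dens U = rho / t by rewrite e1 mulfK.
have DD : dens (a *: U + sg *: mk3 (dens U * v) (mom U * v + p) (mom U)) =
    rho / t * q.
  by rewrite /dens !mxE /= -!/(dens _) DE /q /x; ring.
have MM : mom (a *: U + sg *: mk3 (dens U * v) (mom U * v + p) (mom U)) =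
    sg * ((ener U + p) * x * q + p).
  rewrite /mom !mxE /= -!/(mom _) e2 /q.
  have -> : sg * ((ener U + p) * x * (a + x) + p) =
    sg * ((ener U + p) * (sg * v * a + x ^+ 2) + p) by rewrite /x; ring.
  rewrite x2.
  have -> : sg * ((ener U + p) * (sg * v * a + v ^+ 2) + p) =
    sg ^+ 2 * (ener U + p) * v * a + sg * ((ener U + p) * v ^+ 2 + p) by ring.
  by rewrite sg2; ring.
have EE : ener (a *: U + sg *: mk3 (dens U * v) (mom U * v + p) (mom U)) =
    (ener U + p) * q - a * p.
  rewrite /ener !mxE /= -!/(ener _) e2 /q /x; ring.
have at2 : a * t ^+ 2 = q - x * q1 by rewrite t2 -x2 /q /q1; ring.
apply/admissibleE; rewrite DD MM EE [(sg * _) ^+ 2]exprMn sg2 mul1r; split.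
- by rewrite mulr_gt0// divr_gt0.
- rewrite HE -(pmulr_lgt0 _ (exprn_gt0 2 t0)) mulrBl mulrAC divfK ?expf_neq0//.
  rewrite mulrAC at2.
  (* The energy times [t ^+ 2] is [(rho + k p) q + p x q1]. *)
  suff : `|p * x * q1| < (rho + k * p) * q.
    by rewrite ltr_norml => /andP[? ?]; lra.
  have kp0 : 0 < rho + k * p by rewrite addr_gt0// mulr_gt0//; lra.
  apply: (@le_lt_trans _ _ (p * `|q1|)).
    rewrite (normrM (p * x)) (normrM p) xv (gtr0_norm p0) -mulrA ler_pM2l// ler_piMl// ltW//.
  rewrite -(ltr_pXn2r (ltn0Sn 1)) ?nnegrE ?mulr_ge0 ?(ltW p0) ?(ltW kp0) ?(ltW q0)//.
  rewrite !exprMn real_normK ?num_real//.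
  by have := mulr_gt0 (exprn_gt0 2 r0) (exprn_gt0 2 q0); lra.
- rewrite HE -subr_gt0 -(pmulr_lgt0 _ (exprn_gt0 2 t0)).
  set w := rho + (1 + k) * p.
  have qE : a + x = q by [].
  have q1E : 1 + x * a = q1 by [].
  have t2x : 1 - x ^+ 2 = t ^+ 2 by rewrite x2.
  have qq : (a ^+ 2 - 1) * t ^+ 2 = q ^+ 2 - q1 ^+ 2.
    by rewrite -t2x -qE -q1E; ring.
  (* The result equals [((w - p)^2 - rho^2) q^2 - p^2 q1^2] with [w - p = rho + k p], which is
     positive by [energy]. *)
  have -> : ((w / t ^+ 2 * q - a * p) ^+ 2 -
      ((rho / t * q) ^+ 2 + (w / t ^+ 2 * x * q + p) ^+ 2)) * t ^+ 2 =
      w ^+ 2 * q ^+ 2 * ((1 - x ^+ 2) / t ^+ 2) - 2 * w * p * q * (a + x)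
      + p ^+ 2 * ((a ^+ 2 - 1) * t ^+ 2) - rho ^+ 2 * q ^+ 2.
    by clearbody x q w; field.
  rewrite t2x qE qq divff ?expf_neq0// /w.
  move: energy; lra.
Qed.

End LaxFriedrichsSplitting.

(** * Convex decomposition of the updated cell average *)

Lemma lax_friedrichs_decomposition (R : realType) (n : nat) (w a dt dx : R)
    (Pi Ul Ur Vl Vr Fl Fr Gl Gr : 'cV[R]_n) : dx != 0 ->
  (w *: Ul + w *: Ur + (1 - 2 * w) *: Pi) +
  dt *: - (dx^-1 *: ((1 / 2) *: (Fr + Gl - a *: (Vl - Ur))
                     - (1 / 2) *: (Gr + Fl - a *: (Ul - Vr)))) =
  (1 - 2 * w) *: Pi + (w - dt / dx * a) *: Ul + (w - dt / dx * a) *: Ur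
  + (dt / dx / 2) *: (a *: Ur + (-1) *: Fr)
  + (dt / dx / 2) *: (a *: Ul + 1 *: Fl)
  + (dt / dx / 2) *: (a *: Vl + (-1) *: Gl)
  + (dt / dx / 2) *: (a *: Vr + 1 *: Gr).
Proof. by move=> dx0; apply/matrixP => k j; rewrite !mxE; field. Qed.

(** [Ul] and [Ur] are the end values of the cell, [Vl] and [Vr] the adjacent values in the right and
    left neighbours. *)
Lemma lax_friedrichs_update (R : realType) (gamma : R) (w a dt dx : R)
    (Pi Ul Ur Vl Vr : 'cV[R]_3) :
  1 < gamma <= 2 -> 0 < dx -> 0 <= dt -> 0 < 1 - 2 * w -> dt / dx * a <= w ->
  admissible Pi ->
  {in [:: Ul; Ur; Vl; Vr], forall U, admissible U /\ rho1 gamma U <= a} ->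
  admissible ((w *: Ul + w *: Ur + (1 - 2 * w) *: Pi) +
    dt *: - (dx^-1 *:
      ((1 / 2) *: (flux gamma Ur + flux gamma Vl - a *: (Vl - Ur))
       - (1 / 2) *: (flux gamma Vr + flux gamma Ul - a *: (Ul - Vr))))).
Proof.
move=> hgamma dx0 dt0 w0 wa aPi adm.
rewrite lax_friedrichs_decomposition ?gt_eqF//.
have l2 : 0 <= dt / dx / 2 by rewrite divr_ge0// divr_ge0// ltW.
have g0 : 0 <= w - dt / dx * a by rewrite subr_ge0.
have [aUl rUl] : admissible Ul /\ rho1 gamma Ul <= a.
  by apply: adm; rewrite !inE eqxx.
have [aUr rUr] : admissible Ur /\ rho1 gamma Ur <= a.
  by apply: adm; rewrite !inE eqxx orbT.
have [aVl rVl] : admissible Vl /\ rho1 gamma Vl <= a.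
  by apply: adm; rewrite !inE eqxx !orbT.
have [aVr rVr] : admissible Vr /\ rho1 gamma Vr <= a.
  by apply: adm; rewrite !inE eqxx !orbT.
have sp sg U : sg ^+ 2 = 1 -> admissible U -> rho1 gamma U <= a ->
  admissible (a *: U + sg *: flux gamma U) by exact: lax_friedrichs_splitting.
have sgN : (-1) ^+ 2 = 1 :> R by rewrite sqrrN expr1n.
have sgP : 1 ^+ 2 = 1 :> R by rewrite expr1n.
(* The weights peeled off may vanish; the sum stays in the open cone because [Pi] has the positive
   weight [1 - 2 w]. *)
do 4 (apply: admissibleDZ; [by []| |exact: sp]).
by do 2 (apply: admissibleDZ; [by []| |by []]); exact: admissibleZ.
Qed.

(** For [a = 0] the quotient in the hypothesis is 0 by convention, and the conclusion reads
    [0 <= w]. *)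
Lemma cfl_le (R : realType) (w a dt dx : R) : 0 < w -> 0 <= a -> 0 < dx ->
  dt <= w * dx / a -> dt / dx * a <= w.
Proof.
move=> w0; rewrite le_eqVlt => /predU1P[<-|a0] dx0 h.
  by rewrite mulr0 ltW.
by rewrite mulrAC ler_pdivrMr// -ler_pdivlMr.
Qed.

Theorem theorem3p1 (R : realType) (gamma : R) (hgamma : 1 < gamma <= 2)
  (N : nat) (x0 dx dt : R) (hdx : 0 < dx) (hdt : 0 < dt)
  (lw : 'I_3 -> R) (hlw : forall n, 0 < lw n) (hlw1 : \sum_n lw n = 1)
  (eps : R) (heps : 0 < eps)
  (troubled : nat -> bool) (Ubar Vbar Vlim : nat -> 'cV[R]_3)
  (Roe Rm : nat -> 'M[R]_3)
  (hRoe : forall i, (i < N.+3)%N ->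
    roe_matrix gamma (Ubar i) (Ubar i.+1) (Roe i))
  (hRm : forall i, (i < N.+3)%N -> right_eigenbasis (Roe i) (Rm i))
  (hU : forall i, (i < N.+4)%N -> admissible (Ubar i))
  (hCFL : dt <= glw 0 * dx /
    alpha gamma N x0 dx lw eps troubled Ubar Vbar Vlim Rm) :
  forall i, (2 <= i <= N.+1)%N ->
    admissible (Ubar i +
      dt *: L_U gamma N x0 dx lw eps troubled Ubar Vbar Vlim Rm i).
Proof.
move: hCFL; rewrite /L_U /Fhat; set a := alpha _ _ _ _ _ _ _ _ _ _ _.
pose Ul := Uleft N x0 dx lw eps troubled Ubar Vbar Vlim Rm.
pose Ur := Uright N x0 dx lw eps troubled Ubar Vbar Vlim Rm.
rewrite -/Ul -/Ur => hCFL i /andP[i2 iN].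
have alpha_ge j : (1 <= j < N.+2)%N ->
    Num.max (rho1 gamma (Ur j)) (rho1 gamma (Ul j.+1)) <= a.
  move=> jN; rewrite /a /alpha.
  apply: (le_bigmax_seq 0 j xpredT
    (fun j => Num.max (rho1 gamma (Ur j)) (rho1 gamma (Ul j.+1)))) => //.
  by rewrite mem_index_iota.
have a0 : 0 <= a by exact: bigmax_ge_id.
(* The speed bounds come from the interfaces [i] and [i.-1] of the cell; [2 <= i] keeps the latter
   in the range of [alpha]. *)
have i1E : (i.-1).+1 = i by rewrite prednK// (leq_trans _ i2).
have := alpha_ge i; rewrite ge_max (ltnW i2) /= ltnS iN => /(_ isT)/andP[ar al].
have i1 : (1 <= i.-1 < N.+2)%N.
  by apply/andP; split; [rewrite -ltnS i1E|rewrite (leq_ltn_trans (leq_pred i))].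
have := alpha_ge _ i1; rewrite ge_max i1E => /andP[br bl].
have aUl j : (j < N.+4)%N -> admissible (Ul j) by move=> jN; exact: admissible_Upcp.
have aUr j : (j < N.+4)%N -> admissible (Ur j) by move=> jN; exact: admissible_Upcp.
have iN4 : (i < N.+4)%N by rewrite ltnW// ltnS ltnW// ltnS leqW.
have aPi := admissible_remainder_Upcp x0 dx lw eps troubled Vbar Vlim Rm hU iN4.
have decomp := remainder_decomposition Ubar
  (Upcp N x0 dx lw eps troubled Ubar Vbar Vlim Rm i) i.
move: aPi decomp; rewrite -/(Uleft _ _ _ _ _ _ _ _ _ _ i).
rewrite -/(Uright _ _ _ _ _ _ _ _ _ _ i) -/(Ul i) -/(Ur i).
move: (remainder _ _ _) => Pi aPi decomp.
(* [glw ord_max] and [glw 0] agree by computation. *)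
have -> : Ubar i = glw 0 *: Ul i + glw 0 *: Ur i + (1 - 2 * glw 0) *: Pi.
  exact: decomp.
have [aUli aUri aUlS aUrP] : [/\ admissible (Ul i), admissible (Ur i),
    admissible (Ul i.+1) & admissible (Ur i.-1)].
  split; [exact: aUl|exact: aUr|apply: aUl|apply: aUr].
    by rewrite !ltnS leqW.
  exact: leq_ltn_trans (leq_pred i) iN4.
have cfl := cfl_le _ a0 hdx hCFL; clear hCFL decomp aUl aUr alpha_ge.
clearbody Ul Ur a.
have w2 : 0 < 1 - 2 * glw 0 :> R.
  by clear; rewrite /glw /=; lra.
have w0 : 0 < glw 0 :> R by clear; rewrite /glw /= divr_gt0.
apply: (lax_friedrichs_update hgamma hdx (ltW hdt) w2 (cfl w0) aPi).
move=> U; rewrite !inE => /or4P[] /eqP->.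
- exact: (conj aUli bl).
- exact: (conj aUri ar).
- exact: (conj aUlS al).
- exact: (conj aUrP br).
Qed.
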